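(* Let $\mathcal{S}(\mathbf{c})=\{\mathbf{c}(\tau)+t(0,1,0):\tau\in I,\ t\in\mathbb{R}\}$ be a cylindrical support surface symmetric about the $yz$-plane. Let $s_0>0$, $c\in\mathbb{R}$, and let $\Sigma=\{(x,y,c): -s_0\le x\le s_0,\ y\in\mathbb{R}\}$ be a horizontal planar strip which is a capillary surface on $\mathcal{S}(\mathbf{c})$ with contact angle $\gamma\in(0,\pi)$, meeting $\mathcal{S}(\mathbf{c})$ exactly along the two lines $L_{s_0}^{\pm}=\{x=\pm s_0,\ z=c\}$, where $(\pm s_0,0,c)=\mathbf{c}(\pm\tau_0)$. Let $\kappa(\tau_0)$ be the (signed) curvature of $\mathbf{c}$ at the contact points. 1. If $\kappa(\tau_0)>0$, then $\Sigma$ is unstable. In fact, let $\beta$ be the (unique) solution in the interval $\left(\frac{\kappa(\tau_0)}{\sin\gamma},\infty\right)$ of $$e^{4\beta s_0}=\left(\frac{\beta\sin\gamma+\kappa(\tau_0)}{\beta\sin\gamma-\kappa(\tau_0)}\right)^2,$$ and let $h_0=2\pi/\beta$. If $h>h_0$, then the rectangular piece $\Sigma_h=\{(x,y,c)\in\Sigma: 0\le y\le h\}$ of length $h$ is unstable. 2. If $\kappa(\tau_0)\le 0$, then $\Sigma$ is strongly stable.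
   Context: Setting. $\mathbf{c}(\tau)=(x(\tau),0,z(\tau))$, $\tau\in I$, is a smooth regular embedded curve in the $xz$-plane, $I$ is an interval symmetric about $0$, and $\mathbf{c}(-\tau)=(-x(\tau),0,z(\tau))$. The surface $\mathcal{S}(\mathbf{c})$ separates $\mathbb{R}^3$ into two domains. A capillary surface $\Sigma$ on $\mathcal{S}(\mathbf{c})$ is a surface of constant mean curvature lying in one of these domains, with $\partial\Sigma\subset\mathcal{S}(\mathbf{c})$, which together with a region of $\mathcal{S}(\mathbf{c})$ bounds a domain $\Omega$ (the fluid), and which makes a constant angle $\gamma$ with $\mathcal{S}(\mathbf{c})$ along $\partial\Sigma$. Here $\cos\gamma=\langle N,\widetilde N\rangle$, where $N$ is the unit normal of $\Sigma$ pointing into $\Omega$ and $\widetilde N$ is the unit normal of $\mathcal{S}(\mathbf{c})$ pointing out of $\Omega$. Curvature sign. $\kappa$ denotes the curvature of $\mathbf{c}$ computed with respect to the unit normal $-\widetilde N$ (so $\kappa=\langle \mathbf{c}'',-\widetilde N\rangle$ if $\mathbf{c}$ is parametrized by arc length). By symmetry $\kappa(-\tau_0)=\kappa(\tau_0)$. Stability. For a capillary surface $\Sigma$ put $$Q[u]=\int_\Sigma\left(|\nabla u|^2-|A|^2u^2\right)d\Sigma-\int_{\partial\Sigma}\mathbf{q}\,u^2\,ds,\qquad \mathbf{q}=\frac{\kappa}{\sin\gamma}+\cot\gamma\,A(\nu,\nu),$$ where $A$ is the second fundamental form of $\Sigma$ with respect to $N$ and $\nu$ is the exterior unit conormal of $\partial\Sigma$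 in $\Sigma$. For the planar strip $A=0$ and $\mathbf{q}=\kappa(\tau_0)/\sin\gamma$ on $\partial\Sigma$. The non-compact surface $\Sigma$ is stable if $Q[u]\ge0$ for all smooth $u$ on $\Sigma$ (up to the boundary, not required to vanish on $\partial\Sigma$) with compact support and $\int_\Sigma u\,d\Sigma=0$. It is unstable if it is not stable, and strongly stable if $Q[u]\ge 0$ for all smooth compactly supported $u$, without the zero-mean condition. For the rectangular piece $\Sigma_h$ the same definitions are used with functions $u\in C^\infty(\Sigma_h)$ vanishing on the sides $y=0$ and $y=h$ (and free on the sides $x=\pm s_0$), the boundary integral being taken over the sides $x=\pm s_0$. In particular $\Sigma_h$ is unstable if there is such a $u$ with $\int_{\Sigma_h}u=0$ and $Q[u]<0$. *)

(* Defs.v *)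
From HB Require Import structures.
From mathcomp Require Import all_boot all_order all_algebra.
From mathcomp Require Import all_classical all_reals all_analysis.

Set Implicit Arguments.
Unset Strict Implicit.
Unset Printing Implicit Defensive.

Import Order.TTheory GRing.Theory Num.Theory.
Import numFieldNormedType.Exports.

Local Open Scope ring_scope.
Local Open Scope classical_set_scope.

(* [f] is C^oo on [A], up to the boundary if [A] is not open: every iterated
   directional derivative 'D_v1 (... ('D_vk f)) is Frechet differentiable on
   some open neighbourhood of [A]. *)
Definition smooth_on {R : realType} {V W : normedModType R}
    (A : set V) (f : V -> W) : Prop :=
  exists2 U : set V, open U /\ A `<=` U &
    forall (l : seq V) (p : V), U p ->
      differentiable (foldr (fun v (g : V -> W) => 'D_v g) f l) p.

Definition frontier {T : topologicalType} (A : set T) : set T :=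
  closure A `\` A°.

Definition domain {T : topologicalType} (A : set T) : Prop :=
  [/\ open A, connected A & A !=set0].

Definition separates {T : topologicalType} (S D1 D2 : set T) : Prop :=
  [/\ domain D1, domain D2, D1 `&` D2 = set0 & D1 `|` D2 = ~` S].

Definition vec3 {R : realType} (x y z : R) : 'rV[R]_3 :=
  \row_(i < 3) [:: x; y; z]`_i.

Definition dot {R : realType} (u v : 'rV[R]_3) : R := \sum_i u 0 i * v 0 i.

(* at the point [p], the direction [v] points into [A] (and [- v] out of it) *)
Definition points_into {R : realType} (A : set 'rV[R]_3)
    (p v : 'rV[R]_3) : Prop :=
  \forall t \near 0^'+, A (p + t *: v) /\ ~ A (p - t *: v).

Definition curve {R : realType} (x z : R -> R) (t : R) : 'rV[R]_3 :=
  vec3 (x t) 0 (z t).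

Record symmetric_curve {R : realType} (I : set R) (x z : R -> R) : Prop := {
  curve_interval : is_interval I ;
  curve_dom_sym : forall t, I t -> I (- t) ;
  curve_sym : forall t, I t -> x (- t) = - x t /\ z (- t) = z t ;
  curve_smooth : smooth_on I (curve x z) ;
  curve_regular : forall t, I t -> derive1 (curve x z) t != 0 ;
  (* embedded: injective, with continuous inverse on the image *)
  curve_inj : forall s t, I s -> I t -> curve x z s = curve x z t -> s = t ;
  curve_embedded : forall t, I t -> forall e : R, 0 < e ->
    \forall p \near curve x z t,
      forall s, I s -> curve x z s = p -> `|s - t| < e }.

Definition cylinder_param {R : realType} (x z : R -> R) (t y : R)
  : 'rV[R]_3 := curve x z t + y *: vec3 0 1 0.

Definition cylinder {R : realType} (I : set R) (x z : R -> R)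
  : set 'rV[R]_3 :=
  [set p | exists2 t, I t & exists y, p = cylinder_param x z t y].

Definition unit_normal_cylinder {R : realType} (I : set R) (x z : R -> R)
    (Nt : 'rV[R]_3 -> 'rV[R]_3) : Prop :=
  {within cylinder I x z, continuous Nt} /\
  forall t y, I t ->
    let n := Nt (cylinder_param x z t y) in
    [/\ dot n n = 1, dot n (derive1 (curve x z) t) = 0 & dot n (vec3 0 1 0) = 0].

(* Curvature with respect to the unit normal [- Nt]. For an arbitrary regular
   parametrization, <c'', n> / |c'|^2 is the value of <c'', n> in the
   arc-length parametrization, as n is orthogonal to c'. *)
Definition curvature {R : realType} (x z : R -> R)
    (Nt : 'rV[R]_3 -> 'rV[R]_3) (t : R) : R :=
  dot (derive1n 2 (curve x z) t) (- Nt (curve x z t))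
    / dot (derive1 (curve x z) t) (derive1 (curve x z) t).

(* The strip and its pieces are described in the coordinates (x, y), the
   surface itself being the image under [plane_param c]. Since this map is
   isometric, gradients, areas and lengths are the Euclidean ones. *)
Definition plane_param {R : realType} (c : R) (p : R * R) : 'rV[R]_3 :=
  vec3 p.1 p.2 c.

Definition rect {R : realType} (s0 : R) (J : set R) : set (R * R) :=
  [set p | - s0 <= p.1 <= s0 /\ J p.2].

Definition e1 {R : realType} : R * R := (1, 0).
Definition e2 {R : realType} : R * R := (0, 1).

Definition unit_normal_strip {R : realType} (s0 c : R)
    (N : R * R -> 'rV[R]_3) : Prop :=
  {within rect s0 setT, continuous N} /\
  forall p, rect s0 setT p ->
    [/\ dot (N p) (N p) = 1, dot (N p) ('D_e1 (plane_param c) p) = 0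
      & dot (N p) ('D_e2 (plane_param c) p) = 0].

(* second fundamental form A(v, w) with respect to [N] *)
Definition sff {R : realType} (c : R) (N : R * R -> 'rV[R]_3)
    (p v w : R * R) : R :=
  dot ('D_v ('D_w (plane_param c)) p) (N p).

(* |A|^2 (the frame (e1, e2) is orthonormal) *)
Definition sff_norm2 {R : realType} (c : R) (N : R * R -> 'rV[R]_3)
    (p : R * R) : R :=
  sff c N p e1 e1 ^+ 2 + sff c N p e1 e2 ^+ 2
  + sff c N p e2 e1 ^+ 2 + sff c N p e2 e2 ^+ 2.

Definition mean_curvature {R : realType} (c : R) (N : R * R -> 'rV[R]_3)
    (p : R * R) : R :=
  (sff c N p e1 e1 + sff c N p e2 e2) / 2.

(* The strip {-s0 <= x <= s0, z = c} is a capillary surface, with fluid domain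
   [Omega] and contact angle [gamma], on the cylinder over (x, z); it lies on
   the side [D] of the cylinder. [N] is the unit normal of the strip pointing
   into [Omega], [Nt] the unit normal of the cylinder pointing out of [Omega]. *)
Record capillary_strip {R : realType} (I : set R) (x z : R -> R)
    (s0 c t0 gamma : R) (D Omega W : set 'rV[R]_3)
    (N : R * R -> 'rV[R]_3) (Nt : 'rV[R]_3 -> 'rV[R]_3) : Prop := {
  strip_cmc : exists H, forall p, rect s0 setT p -> mean_curvature c N p = H ;
  strip_contact : I t0 /\ curve x z t0 = vec3 s0 0 c ;
  strip_meets : (plane_param c @` rect s0 setT) `&` cylinder I x z =
    plane_param c @` [set p | p.1 = s0 \/ p.1 = - s0] ;
  strip_side : plane_param c @` [set p | - s0 < p.1 < s0] `<=` D ;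
  fluid_domain : domain Omega ;
  fluid_side : Omega `<=` D ;
  fluid_wetted : W `<=` cylinder I x z ;
  fluid_frontier : frontier Omega = (plane_param c @` rect s0 setT) `|` W ;
  strip_normal : unit_normal_strip s0 c N ;
  strip_normal_into : forall p : R * R, - s0 < p.1 < s0 ->
    points_into Omega (plane_param c p) (N p) ;
  wall_normal : unit_normal_cylinder I x z Nt ;
  wall_normal_out : forall p, W p -> ~ (plane_param c @` rect s0 setT) p ->
    points_into Omega p (- Nt p) ;
  strip_angle : forall p, p.1 = s0 \/ p.1 = - s0 ->
    dot (N p) (Nt (plane_param c p)) = cos gamma }.

(* q at the boundary points (s s0, y) for s = 1 or s = -1; there the exterior
   conormal is (s, 0), and the curve parameter is s t0. *)
Definition robin {R : realType} (x z : R -> R) (s0 c t0 gamma : R)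
    (N : R * R -> 'rV[R]_3) (Nt : 'rV[R]_3 -> 'rV[R]_3) (s y : R) : R :=
  curvature x z Nt (s * t0) / sin gamma
  + cos gamma / sin gamma * sff c N (s * s0, y) (s, 0) (s, 0).

Definition area {R : realType} :=
  (@lebesgue_measure R \x @lebesgue_measure R)%E.

(* Q[u] over the part of the strip with y in [J]; the boundary integral is
   over the sides x = s0 and x = - s0. *)
Definition Qform {R : realType} (x z : R -> R) (s0 c t0 gamma : R)
    (N : R * R -> 'rV[R]_3) (Nt : 'rV[R]_3 -> 'rV[R]_3)
    (J : set R) (u : R * R -> R) : R :=
  \int[area]_(p in rect s0 J)
      ('D_e1 u p ^+ 2 + 'D_e2 u p ^+ 2 - sff_norm2 c N p * u p ^+ 2)
  - (\int[lebesgue_measure]_(y in J)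
        (robin x z s0 c t0 gamma N Nt 1 y * u (s0, y) ^+ 2)
     + \int[lebesgue_measure]_(y in J)
        (robin x z s0 c t0 gamma N Nt (-1) y * u (- s0, y) ^+ 2)).

Definition strip_test {R : realType} (s0 : R) (u : R * R -> R) : Prop :=
  smooth_on (rect s0 setT) u /\
  compact (closure (rect s0 setT `&` [set p | u p != 0])).

Definition piece_test {R : realType} (s0 h : R) (u : R * R -> R) : Prop :=
  smooth_on (rect s0 `[0, h]) u /\
  forall a, - s0 <= a <= s0 -> u (a, 0) = 0 /\ u (a, h) = 0.

Definition strip_strongly_stable {R : realType} (x z : R -> R)
    (s0 c t0 gamma : R) (N : R * R -> 'rV[R]_3)
    (Nt : 'rV[R]_3 -> 'rV[R]_3) : Prop :=
  forall u, strip_test s0 u -> 0 <= Qform x z s0 c t0 gamma N Nt setT u.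

Definition strip_stable {R : realType} (x z : R -> R)
    (s0 c t0 gamma : R) (N : R * R -> 'rV[R]_3)
    (Nt : 'rV[R]_3 -> 'rV[R]_3) : Prop :=
  forall u, strip_test s0 u ->
    \int[area]_(p in rect s0 setT) u p = 0 ->
    0 <= Qform x z s0 c t0 gamma N Nt setT u.

Definition piece_stable {R : realType} (x z : R -> R)
    (s0 c t0 gamma : R) (N : R * R -> 'rV[R]_3)
    (Nt : 'rV[R]_3 -> 'rV[R]_3) (h : R) : Prop :=
  forall u, piece_test s0 h u ->
    \int[area]_(p in rect s0 `[0, h]) u p = 0 ->
    0 <= Qform x z s0 c t0 gamma N Nt `[0, h] u.

(* Main.v *)
Require Import Defs.
From mathcomp Require Import all_boot all_order all_algebra.
From mathcomp Require Import all_classical all_reals all_analysis.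
From mathcomp Require Import ring lra measurable_realfun.
Set Implicit Arguments.
Unset Strict Implicit.
Unset Printing Implicit Defensive.
Import Order.TTheory GRing.Theory Num.Theory.
Import numFieldNormedType.Exports.
Local Open Scope ring_scope.
Local Open Scope classical_set_scope.

(** The strip is flat, so A = 0, and the normal of the cylinder at c(-t) is the
mirror image of the one at c(t): hence q is the same constant
q = kappa / sin gamma on both boundary lines. If q <= 0, every term of Q is
nonnegative.

If q > 0, the equation for beta says beta tanh(beta s0) = q. Put
f(x) = 2 cosh(beta x), k = 2 pi / h < beta and g(y) = sin(k y). The function
u = f g has mean zero and vanishes at y = 0 and y = h. From f'' = beta^2 f and
f'(s0) = q f(s0), the integral of f'^2 + beta^2 f^2 is 2 q f(s0)^2, and the
integral of g'^2 is k^2 times that of g^2, so that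
Q[u] = (k^2 - beta^2) (int f^2) (int g^2) < 0.

On the whole strip take u(x, y) = b'(y / L) for a smooth bump b: the mean
is zero, the Dirichlet term is O(1 / L), while the boundary term grows like L,
since int_[-L,0] g^2 >= int_[-L,0] (2 b(0) g - b(0)^2) = b(0)^2 L for
g(y) = b'(y / L). *)

(** * Integrals over intervals and rectangles *)

Section Integrals.
Context {R : realType}.
Implicit Types (f g F : R -> R) (a b : R).
Local Notation mu := (@lebesgue_measure R).

Lemma continuous_integrable_itv f a b : continuous f ->
  mu.-integrable `[a, b] (EFin \o f).
Proof.
move=> cf; apply: continuous_compact_integrable; first exact: segment_compact.
exact: continuous_subspaceT.
Qed.

Lemma Rintegral_FTC f F a b : a < b -> continuous f ->
  (forall t, is_derive t (1 : R) F (f t)) ->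
  \int[mu]_(t in `[a, b]) f t = F b - F a.
Proof.
move=> ab cf dF.
have cF t : {for t, continuous F}.
  by apply/differentiable_continuous/derivable1_diffP.
rewrite /Rintegral (@continuous_FTC2 _ _ F) //.
- exact: continuous_subspaceT.
- split=> [t _||].
  + by [].
  + exact/cvg_at_right_filter/cF.
  + exact/cvg_at_left_filter/cF.
- by move=> t _; rewrite derive1E derive_val.
Qed.

Lemma measurable_patch_itv f a b : continuous f ->
  measurable_fun [set: measurableTypeR R] (f \_ `[a, b]).
Proof.
move=> cf; apply/(measurable_restrictT _ _).1 => //.
apply/measurable_funTS; exact: continuous_measurable_fun.
Qed.

Lemma integrable_restrict_itv f a b : continuous f ->
  mu.-integrable setT (EFin \o (f \_ `[a, b])).
Proof.
move=> cf; rewrite -restrict_EFin.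
by apply/(integrable_mkcond _ _).1 => //; exact: continuous_integrable_itv.
Qed.

(** By Tonelli: the iterated integral of the absolute value factors into two one-variable integrals,
    each finite because a continuous function on a segment is integrable. *)
Lemma integrable_prod_restrict f g a b c d :
  continuous f -> continuous g ->
  (@lebesgue_measure R \x @lebesgue_measure R)%E.-integrable setT
    (fun p => ((f \_ `[a, b]) p.1 * (g \_ `[c, d]) p.2)%:E).
Proof.
move=> cf cg.
apply/integrable12ltyP.
  apply/measurable_EFinP/measurable_funM.
    exact: (measurableT_comp (measurable_patch_itv a b cf) measurable_fst).
  exact: (measurableT_comp (measurable_patch_itv c d cg) measurable_snd).
have /integrableP[mF iF] : mu.-integrable setT (EFin \o (f \_ `[a, b])).
  exact: integrable_restrict_itv.
have /integrableP[mG iG] : mu.-integrable setT (EFin \o (g \_ `[c, d])).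
  exact: integrable_restrict_itv.
have measurable_normG : measurable_fun [set: measurableTypeR R]
    (fun y => `|(g \_ `[c, d]) y|%:E)
  by exact: (measurableT_comp (@abse_measurable R setT) mG).
under eq_integral => x _.
  under eq_integral => y _ do rewrite /= normrM EFinM.
  rewrite ge0_integralZl//.
  over.
rewrite ge0_integralZr//=.
- by rewrite lte_mul_pinfty ?ge0_fin_numE ?integral_ge0.
- exact: (measurableT_comp (@abse_measurable R setT) mF).
- by apply: integral_ge0 => y _.
Qed.

Lemma restrict_prod f g (A B : set R) :
  (fun p => f p.1 * g p.2) \_ (A `*` B) = fun p => (f \_ A) p.1 * (g \_ B) p.2.
Proof.
apply/funext => -[x y]; rewrite !patchE in_setX/=.
by case: (x \in A); case: (y \in B); rewrite /= ?mulr0 ?mul0r.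
Qed.

Lemma integrable_prod f g a b c d : continuous f -> continuous g ->
  (@lebesgue_measure R \x @lebesgue_measure R)%E.-integrable
    (`[a, b] `*` `[c, d]) (EFin \o (fun p => f p.1 * g p.2)).
Proof.
move=> cf cg; apply/(integrable_mkcond _ _).2; first exact: measurableX.
by rewrite restrict_EFin restrict_prod; exact: integrable_prod_restrict.
Qed.

(** Extension by zero turns the rectangle integral into one over the whole product space, where
    Fubini applies and the inner integral comes out as a constant factor. *)
Lemma Rintegral_prod f g a b c d : continuous f -> continuous g ->
  \int[area]_(p in `[a, b] `*` `[c, d]) (f p.1 * g p.2) =
  (\int[mu]_(x in `[a, b]) f x) * \int[mu]_(y in `[c, d]) g y.
Proof.
move=> cf cg; rewrite Rintegral_mkcond restrict_prod /Rintegral.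
rewrite -integral12_prod_meas1; last exact: integrable_prod_restrict.
have iF : mu.-integrable setT (EFin \o (f \_ `[a, b])).
  exact: integrable_restrict_itv.
have iG : mu.-integrable setT (EFin \o (g \_ `[c, d])).
  exact: integrable_restrict_itv.
rewrite /fubini_F/=.
under eq_integral => x _.
  under eq_integral => y _ do rewrite /= EFinM.
  rewrite integralZl//.
  rewrite -[X in (_ * X)%E]fineK; last exact: integrable_fin_num.
  over.
rewrite integralZr// fineM//; last exact: integrable_fin_num.
rewrite [in RHS]integral_mkcond [X in _ = _ * fine X]integral_mkcond.
by rewrite !restrict_EFin.
Qed.

End Integrals.

(** * Smooth functions *)

Section SmoothLine.
Context {R : realType}.
Implicit Types (f g : R -> R) (s t : R) (p q : {poly R}).

Lemma regular_scaleE (s t : R) : s *: t = s * t. Proof. by []. Qed.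

Definition smooth_line f := forall n t, derivable (f^`(n)) t 1.

(** By induction on [n], the n-th derivative stays in the class. The smoothness proofs below only
    have to exhibit a suitable class closed under derivation. *)
Lemma smooth_line_closed (C : (R -> R) -> Prop) :
  (forall f, C f -> exists2 g, C g & forall t, is_derive t (1 : R) f (g t)) ->
  forall f, C f -> smooth_line f.
Proof.
move=> Cd f Cf n; suff [] : C f^`(n) /\ forall t, derivable f^`(n) t 1 by [].
elim: n => [|n [Cfn _]].
  by rewrite derive1n0; split=> // t; have [g _ /(_ t) []] := Cd _ Cf.
rewrite derive1nS; have [g Cg dg] := Cd _ Cfn.
have -> : f^`(n)^`() = g.
  by apply/funext => t; rewrite derive1E; have [_] := dg t.
by split=> // t; have [k _ /(_ t) []] := Cd _ Cg.
Qed.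

Lemma smooth_line_is_derive f t : smooth_line f ->
  is_derive t (1 : R) f ((derive1 f) t).
Proof. by move=> sf; rewrite derive1E; apply: derivableP; exact: (sf 0%N). Qed.

Lemma smooth_line_derive f : smooth_line f -> smooth_line (derive1 f).
Proof. by move=> sf n t; rewrite -derive1Sn; exact: sf. Qed.

Lemma smooth_line_continuous f : smooth_line f -> continuous f.
Proof.
by move=> sf t; apply/differentiable_continuous/derivable1_diffP/(sf 0%N).
Qed.

Lemma smooth_line_cst (k : R) : smooth_line (cst k).
Proof.
apply: (@smooth_line_closed (fun f => exists k, f = cst k)); last by exists k.
by move=> _ [l ->]; exists (cst 0); [exists 0|move=> t; exact: is_derive_cst].
Qed.

(** Products of two smooth functions are not closed under derivation, but their finite sums are, by
    the Leibniz rule. *)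
Inductive prod_sum : (R -> R) -> Prop :=
| prod_sumM f g of smooth_line f & smooth_line g : prod_sum (f * g)
| prod_sumD f g of prod_sum f & prod_sum g : prod_sum (f + g).

Lemma smooth_line_prod_sum f : prod_sum f -> smooth_line f.
Proof.
apply: smooth_line_closed => {}f; elim => {f}.
- move=> f g sf sg; exists (f * (derive1 g) + g * (derive1 f)).
    by apply: prod_sumD; apply: prod_sumM => //; exact: smooth_line_derive.
  by move=> t; have := smooth_line_is_derive t sf;
     have := smooth_line_is_derive t sg => dg df; exact: is_deriveM.
- move=> f g _ [f' Cf' df] _ [g' Cg' dg]; exists (f' + g').
    exact: prod_sumD.
  by move=> t; exact: is_deriveD.
Qed.

Lemma smooth_lineM f g : smooth_line f -> smooth_line g -> smooth_line (f * g).
Proof. by move=> sf sg; apply/smooth_line_prod_sum/prod_sumM. Qed.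

Lemma smooth_lineD f g : smooth_line f -> smooth_line g -> smooth_line (f + g).
Proof.
move=> sf sg; rewrite -[f]mulr1 -[g]mulr1.
by apply/smooth_line_prod_sum/prod_sumD; apply: prod_sumM => //;
   exact: smooth_line_cst.
Qed.

Lemma is_derive_affine (k l t : R) :
  is_derive t (1 : R) (fun t => k * t + l) k.
Proof. by apply: is_derive_eq; rewrite addr0 regular_scaleE mulr1. Qed.

(** Each derivation brings out a factor [k], so the closed class must allow a constant multiple of
    the composite. *)
Lemma smooth_line_affine f (k l : R) : smooth_line f ->
  smooth_line (fun t => f (k * t + l)).
Proof.
move=> sf; pose C g := exists c f, smooth_line f /\ g = fun t => c * f (k * t + l).
apply: (@smooth_line_closed C); last first.
  by exists 1, f; split=> //; apply/funext => t; rewrite mul1r.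
move=> _ [c [g [sg ->]]]; exists (fun t => c * k * (derive1 g) (k * t + l)).
  by exists (c * k), (derive1 g); split=> //; exact: smooth_line_derive.
move=> t; have := is_derive_affine k l t.
have := smooth_line_is_derive (k * t + l) sg => dg da.
have dc := @is_derive1_comp R g (fun t => k * t + l) t _ _ dg da.
have dz := @is_deriveZ R R R _ c t 1 _ dc.
by apply: (is_derive_eq dz); rewrite regular_scaleE; ring.
Qed.

Lemma smooth_line_expR : smooth_line expR.
Proof.
apply: (@smooth_line_closed (eq expR)) => // _ <-.
by exists expR => // t; exact: is_derive_expR.
Qed.

(** The closed class is the linear span of sine and cosine. *)
Lemma smooth_line_sin : smooth_line sin.
Proof.
pose C (f : R -> R) := exists a b : R, f = fun t => a * sin t + b * cos t.
apply: (@smooth_line_closed C); last first.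
  by exists 1, 0; apply/funext => t; rewrite mul1r mul0r addr0.
move=> _ [a [b ->]]; exists (fun t => - b * sin t + a * cos t).
  by exists (- b), a.
move=> t; apply: is_derive_eq.
by rewrite !regular_scaleE mulrN mulNr addrC.
Qed.

End SmoothLine.

(** * Functions p(1/t) exp(-1/t), flat at the origin *)

Section FlatExp.
Context {R : realType}.
Implicit Types (s t : R) (p q : {poly R}).

(* Allowing a polynomial factor in 1/t makes the class closed under derivation. *)
Definition flat_exp p t : R := if 0 < t then p.[t^-1] * expR (- t^-1) else 0.

(** Termwise from s^i <= i! e^s, which is where the weights in the witness come from. *)
Lemma horner_le_expR p : exists C, forall s, 0 <= s -> `|p.[s]| <= C * expR s.
Proof.
exists (\sum_(i < size p) `|p`_i| * i`!%:R) => s s0.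
rewrite horner_coef mulr_suml (le_trans (ler_norm_sum _ _ _))//.
apply: ler_sum => i _; rewrite normrM -mulrA ler_wpM2l//.
rewrite normrX (ger0_norm s0).
case: (i : nat) => [|n]; first by rewrite expr0 mul1r -expR0 ler_expR.
rewrite -ler_pdivrMl ?ltr0n ?fact_gt0// mulrC.
by apply: le_trans (expR_ge1Dxn n s0); rewrite lerDr.
Qed.

(** With s = 1/t, the exponential bound for p X^2 reads |p(s)| s^2 <= C e^s, which is the claim
    after division by s^2 e^s. Quadratic decay is what gives derivative zero at the origin. *)
Lemma flat_exp_le p : exists C, forall t, `|flat_exp p t| <= C * t ^+ 2.
Proof.
have [C hC] := horner_le_expR (p * 'X^2).
have C0 : 0 <= C.
  have := hC 0 (lexx _); rewrite expR0 mulr1.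
  by move=> /(le_trans (normr_ge0 _)).
exists C => t; rewrite /flat_exp; case: ifPn => [t0|_]; last first.
  by rewrite normr0 mulr_ge0// sqr_ge0.
have := hC t^-1; rewrite invr_ge0 => /(_ (ltW t0)).
rewrite hornerM hornerXn normrM normrX (@gtr0_norm _ t^-1) ?invr_gt0//.
rewrite exprVn ler_pdivrMr ?exprn_gt0// => le1.
rewrite normrM (gtr0_norm (expR_gt0 _)) expRN ler_pdivrMr ?expR_gt0//.
by rewrite mulrAC.
Qed.

(** The bound forces f(0) = 0, and the difference quotient at 0 is then at most |C| |h|. *)
Lemma is_derive0_quadratic (f : R -> R) (C : R) :
  (forall t, `|f t| <= C * t ^+ 2) -> is_derive (0 : R) (1 : R) f 0.
Proof.
move=> fC; have f0 : f 0 = 0.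
  by apply/eqP; rewrite -normr_le0; have := fC 0; rewrite expr0n mulr0.
have cf : h^-1 *: (f (h *: (1 : R) + 0) - f 0) @[h --> 0^'] --> (0 : R).
  apply/cvgr0Pnorm_le => e e0; near=> h.
  have h0 : h != 0 by near: h; exact: nbhs_dnbhs_neq.
  rewrite f0 subr0 addr0 !regular_scaleE mulr1 normrM normfV.
  rewrite ler_pdivrMl ?normr_gt0//.
  rewrite (le_trans (fC h))//.
  (* The added 1 keeps the denominator positive when [C] is zero. *)
  have hd : `|h| < e / (`|C| + 1).
    near: h; apply: dnbhs0_lt; rewrite divr_gt0// ltr_wpDl//.
  move: hd; rewrite ltr_pdivlMr ?ltr_wpDl// -(real_normK (num_real h)).
  have := ler_norm C; have := normr_ge0 h; have := normr_ge0 C; nra.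
split; first by apply/cvg_ex; exists 0.
exact/cvg_lim.
Unshelve. all: by end_near.
Qed.

(** For t > 0 put s = 1/t: then d/dt = - s^2 d/ds, and d/ds of p(s) e^(-s) is (p' - p)(s) e^(-s),
    whence the polynomial X^2 (p - p'). For t < 0 the function is locally zero, and at 0 the
    quadratic bound applies. *)
Lemma is_derive_flat_exp p t :
  is_derive t (1 : R) (flat_exp p) (flat_exp ('X^2 * (p - p^`())) t).
Proof.
have [t0|t0|<-] := ltgtP 0 t.
- have tN0 : t != 0 by rewrite gt_eqF.
  apply: (@near_eq_is_derive _ _ _ (fun t => p.[t^-1] * expR (- t^-1))).
    near=> u; rewrite /flat_exp ifT//; near: u; exact: lt_nbhsr.
  have dinv : is_derive t (1 : R) (fun t => t^-1) (- t ^- 2).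
    have := @is_deriveV _ id t 1 1 tN0 (is_derive_id _ _).
    by rewrite regular_scaleE mulr1.
  have dexp : is_derive t^-1 (1 : R) (fun s => p.[s] * expR (- s))
      (p^`().[t^-1] * expR (- t^-1) - p.[t^-1] * expR (- t^-1)).
    have dN := @is_deriveNid _ _ t^-1 (1 : R).
    have dE := @is_derive1_comp _ expR -%R t^-1 _ _ (is_derive_expR _) dN.
    have dp := is_derive_poly p t^-1.
    apply: (is_derive_eq (is_deriveM dp dE)) => /=.
    by rewrite !regular_scaleE; ring.
  have := @is_derive1_comp _ (fun s => p.[s] * expR (- s)) (fun t => t^-1)
    t _ _ dexp dinv => /is_derive_eq; apply.
  by rewrite /flat_exp t0 hornerM hornerXn hornerD hornerN exprVn; ring.
- rewrite [X in is_derive _ _ _ X]/flat_exp ltNge (ltW t0) /=.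
  apply: (@near_eq_is_derive _ _ _ (cst 0)).
  near=> u; rewrite /flat_exp ifF//; apply/negbTE; rewrite -leNgt ltW//.
  near: u; exact: lt_nbhsl.
- rewrite {2}/flat_exp ltxx; have [C] := flat_exp_le p.
  exact: is_derive0_quadratic.
Unshelve. all: by end_near.
Qed.

Lemma smooth_line_flat_exp p : smooth_line (flat_exp p).
Proof.
apply: (@smooth_line_closed _ (fun f => exists q, f = flat_exp q)).
  move=> _ [q ->]; exists (flat_exp ('X^2 * (q - q^`()))).
    by eexists.
  exact: is_derive_flat_exp.
by exists p.
Qed.

End FlatExp.

(** * A smooth bump function *)

Section Bump.
Context {R : realType}.

Lemma exists_bump : exists b : R -> R,
  [/\ smooth_line b, forall t, 1 <= `|t| -> b t = 0 & 0 < b 0].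
Proof.
(* This is exp(-1/(1+t)) exp(-1/(1-t)) on (-1, 1): the first factor vanishes for t <= -1, the second
   for t >= 1. *)
exists ((fun t => flat_exp 1 (1 * t + 1)) * (fun t => flat_exp 1 (- 1 * t + 1))).
split.
- by apply: smooth_lineM; apply: smooth_line_affine; exact: smooth_line_flat_exp.
- move=> t; rewrite ler_normr => /orP[] t1; apply/eqP; rewrite mulf_eq0.
    by apply/orP; right; rewrite /flat_exp ifF//; apply/negbTE; lra.
  by apply/orP; left; rewrite /flat_exp ifF//; apply/negbTE; lra.
- rewrite mulr_gt0// /flat_exp mulr0 add0r ltr01 hornerC mul1r; exact: expR_gt0.
Qed.
End Bump.

(** * Separable smooth functions on the plane *)

Section SmoothPlane.
Context {R : realType}.

Lemma is_diff_fst_comp (f : R -> R) (p : R * R) : smooth_line f ->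
  is_diff p (fun q => f q.1) (fun v => v.1 * derive1 f p.1).
Proof.
move=> sf.
have df : differentiable f p.1 by apply/derivable1_diffP; exact: (sf 0%N).
have dfst : differentiable (fst : R * R -> R) p.
  by apply: linear_differentiable => q; exact: cvg_fst.
apply: DiffDef; first exact: (differentiable_comp dfst df).
rewrite (diff_comp dfst df) deriv1E; last exact: (sf 0%N).
by rewrite diff_lin // => q; exact: cvg_fst.
Qed.

Lemma is_diff_snd_comp (f : R -> R) (p : R * R) : smooth_line f ->
  is_diff p (fun q => f q.2) (fun v => v.2 * derive1 f p.2).
Proof.
move=> sf.
have df : differentiable f p.2 by apply/derivable1_diffP; exact: (sf 0%N).
have dsnd : differentiable (snd : R * R -> R) p.
  by apply: linear_differentiable => q; exact: cvg_snd.
apply: DiffDef; first exact: (differentiable_comp dsnd df).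
rewrite (diff_comp dsnd df) deriv1E; last exact: (sf 0%N).
by rewrite diff_lin // => q; exact: cvg_snd.
Qed.

(** Finite sums are allowed because a directional derivative of f(x) g(y) is a sum of two such
    products; the class is thus closed under all iterated directional derivatives. *)
Inductive sep_smooth : (R * R -> R) -> Prop :=
| sep_smoothM f g of smooth_line f & smooth_line g :
    sep_smooth (fun p => f p.1 * g p.2)
| sep_smoothD u v of sep_smooth u & sep_smooth v : sep_smooth (u + v).

Lemma is_diff_sep (f g : R -> R) (p : R * R) :
  smooth_line f -> smooth_line g ->
  is_diff p (fun p => f p.1 * g p.2)
    (fun v => v.1 * (derive1 f p.1 * g p.2) + v.2 * (f p.1 * derive1 g p.2)).
Proof.
move=> sf sg; have df := is_diff_fst_comp p sf; have dg := is_diff_snd_comp p sg.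
apply: (is_diff_eq (is_diffM df dg)).
have aux (a b c d r s : R) :
  a * (s * d) + b * (r * c) = r * (c * b) + s * (a * d) by ring.
by apply/funext => v; rewrite !fctE /= !regular_scaleE; exact: aux.
Qed.

Lemma derive_sep (f g : R -> R) (p v : R * R) :
  smooth_line f -> smooth_line g ->
  'D_v (fun p => f p.1 * g p.2) p =
    v.1 * (derive1 f p.1 * g p.2) + v.2 * (f p.1 * derive1 g p.2).
Proof.
by move=> sf sg; have [df dE] := is_diff_sep p sf sg; rewrite deriveE// dE.
Qed.

Lemma sep_smooth_derive (u : R * R -> R) : sep_smooth u ->
  (forall p, differentiable u p) /\ forall v, sep_smooth ('D_v u).
Proof.
elim=> {u} [f g sf sg|u v _ [du Du] _ [dv Dv]].
- split=> [p|v]; first by have [] := is_diff_sep p sf sg.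
  have -> : 'D_v (fun p => f p.1 * g p.2) =
      (fun p => (cst v.1 * derive1 f) p.1 * g p.2) +
      (fun p => (cst v.2 * f) p.1 * derive1 g p.2).
    by apply/funext => p; rewrite derive_sep// !mulrA.
  apply: sep_smoothD.
  + apply: (sep_smoothM _ sg); apply: smooth_lineM.
      exact: smooth_line_cst.
    exact: smooth_line_derive.
  + apply: (sep_smoothM _ (smooth_line_derive sg)); apply: smooth_lineM => //.
    exact: smooth_line_cst.
- split=> [p|w]; first exact: differentiableD.
  have -> : 'D_w (u + v) = 'D_w u + 'D_w v.
    by apply/funext => p; rewrite deriveD//; exact: diff_derivable.
  exact: sep_smoothD.
Qed.

Lemma sep_smooth_on (A : set (R * R)) u : sep_smooth u -> smooth_on A u.
Proof.
move=> su; exists setT; first by split; [exact: openT|].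
move=> l p _; suff : sep_smooth (foldr (fun v g => 'D_v g) u l).
  by move=> /sep_smooth_derive [].
by elim: l => //= v l /sep_smooth_derive [_]; apply.
Qed.

End SmoothPlane.

(** * The strip and the curvature of the cylinder *)

Section Plane.
Context {R : realType}.

(** The parametrization is affine, so its difference quotient is already constant for nonzero
    increments. *)
Lemma derive_plane_param (c : R) (w : R * R) :
  'D_w (plane_param c) = cst (vec3 w.1 w.2 0).
Proof.
apply/funext => p; apply/cvg_lim => //.
apply: (cvg_trans (near_eq_cvg _) (cvg_cst _)).
near=> h; have h0 : h != 0 by near: h; exact: nbhs_dnbhs_neq.
apply/rowP => i; rewrite !mxE /plane_param /= .
case: i => -[|[|[|//]]] /= _.
- by rewrite addrK [h^-1 * _](mulKf h0).
- by rewrite addrK [h^-1 * _](mulKf h0).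
- by rewrite subrr mulr0.
Unshelve. all: by end_near. Qed.

Lemma sff_plane (c : R) N (p v w : R * R) : sff c N p v w = 0.
Proof.
rewrite /sff derive_plane_param derive_cst /dot big1// => i _.
by rewrite mxE mul0r.
Qed.

Lemma sff_norm2_plane (c : R) N (p : R * R) : sff_norm2 c N p = 0.
Proof. by rewrite /sff_norm2 !sff_plane expr0n !addr0. Qed.

End Plane.

(** * Derivatives on closed intervals, parity and sign *)

Section Curvature.
Context {R : realType}.

Lemma dotE (u v : 'rV[R]_3) :
  dot u v = u 0 0 * v 0 0 + u 0 1 * v 0 1 + u 0 2 * v 0 2.
Proof.
rewrite /dot !big_ord_recl big_ord0 addr0 addrA.
by congr (_ * _ + _ * _ + _ * _); congr (_ 0 _); apply/val_inj.
Qed.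

(** Since [F] is derivable at [t], its derivative can be computed from one side only: from the right
    if t < b, from the left if t = b. Thus endpoints are covered although [F] may be nonzero beyond
    them. *)
Lemma derive1_vanish (F : R -> R) (a b t : R) : a < b ->
  (forall s, a <= s <= b -> F s = 0) -> a <= t <= b ->
  derivable F t 1 -> derive1 F t = 0.
Proof.
move=> ab F0 /andP[at_ tb] dF; rewrite derive1E /derive.
have [tb'|bt] := ltP t b.
  rewrite cvg_at_rightE//; apply/cvg_lim => //.
  apply: (cvg_trans (near_eq_cvg _) (cvg_cst _)).
  near=> h; have h0 : 0 < h by near: h; exact: nbhs_right_gt.
  have hb : h < b - t by near: h; apply: nbhs_right_lt; rewrite subr_gt0.
  by rewrite /= !F0 ?subrr ?scaler0// ?at_ ?ltW// regular_scaleE mulr1; lra.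
rewrite cvg_at_leftE//; apply/cvg_lim => //.
apply: (cvg_trans (near_eq_cvg _) (cvg_cst _)).
near=> h; have h0 : h < 0 by near: h; exact: nbhs_left_lt.
have hb : a - t < h by near: h; apply: nbhs_left_gt; lra.
by rewrite /= !F0 ?subrr ?scaler0// ?at_ ?tb// regular_scaleE mulr1; lra.
Unshelve. all: by end_near. Qed.

(** The function f(-s) - e f(s) vanishes on the closed interval, hence so does its derivative, also
    at the endpoints. The case of interest is t = a, where the symmetry is known on one side
    only. *)
Lemma derive1_reflect (f : R -> R) (e a t : R) : 0 < a ->
  (forall s, - a <= s <= a -> f (- s) = e * f s) -> - a <= t <= a ->
  derivable f t 1 -> derivable f (- t) 1 ->
  derive1 f (- t) = - e * derive1 f t.
Proof.
move=> a0 fe ta /derivableP dft /derivableP dfNt.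
have dfN := @is_derive1_comp _ f -%R t _ _ dfNt (is_deriveNid t 1).
have [dF dFE] := is_deriveB dfN (is_deriveZ e dft).
have := @derive1_vanish _ (- a) a t _ _ ta dF.
rewrite derive1E dFE -!derive1E regular_scaleE mulrN1 => h.
have /eqP := h ltac:(lra) ltac:(by move=> s /fe fes; rewrite !fctE /= fes subrr).
by rewrite subr_eq0 eqr_oppLR mulNr => /eqP.
Qed.

Lemma derive1_coord (C : R -> 'rV[R]_3) (t : R) i : derivable C t 1 ->
  derivable (fun s => C s 0 i) t 1 /\
  derive1 (fun s => C s 0 i) t = derive1 C t 0 i.
Proof.
by move=> dC; split; [move/derivable_mxP : dC; apply|rewrite !derive1E derive_mx// mxE].
Qed.

(** Equal squares leave only w(-a) = w(a) or w(-a) = - w(a); opposite values would force a zero by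
    the intermediate value theorem. *)
Lemma within_continuous_neq0_sqr_eq (w : R -> R) (a : R) : 0 <= a ->
  {within `[- a, a], continuous w} ->
  (forall t, - a <= t <= a -> w t != 0) -> w a ^+ 2 = w (- a) ^+ 2 ->
  w (- a) = w a.
Proof.
move=> a0 cw w0 /eqP; rewrite eqf_sqr => /orP[/eqP//|/eqP waE].
have [t] : exists2 t, t \in `[- a, a]%R & w t = 0.
  apply: IVT => //; first lra.
  by rewrite waE ge_min le_max oppr_ge0 oppr_le0;
    have /orP[] := le_total (w (- a)) 0 => ->; rewrite ?orbT.
by rewrite in_itv => /w0 /eqP.
Qed.

End Curvature.

(** * Equality of the curvatures at mirror points *)

Section CurvatureReflect.
Context {R : realType}.

Lemma vec3E (a b c : R) :
  (vec3 a b c 0 0 = a) * (vec3 a b c 0 1 = b) * (vec3 a b c 0 2 = c).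
Proof. by rewrite !mxE. Qed.

(** Meant for the wall normal along the curve: the normal is continuous only relative to the
    cylinder, and the curve stays in the cylinder only for parameters in the interval. *)
Lemma cvg_restrict_comp {T : topologicalType} (A : set R) (B : set T)
    (f : R -> T) (S : topologicalType) (g : T -> S) (t : R) :
  A t -> (forall s, A s -> B (f s)) -> {for t, continuous f} ->
  {within B, continuous g} -> g (f s) @[s --> within A (nbhs t)] --> g (f t).
Proof.
move=> At AB cf /subspace_continuousP cg.
have := cg (f t) (AB _ At); apply: cvg_trans => P.
move=> gP; have cgP : \forall s \near t, B (f s) -> P (g (f s)) := cf _ gP.
change (\forall s \near t, A s -> P (g (f s))).
by near=> s => As; apply: (near cgP s) => //; exact: AB.
Unshelve. all: by end_near. Qed.

Lemma derive1_coord_reflect (C : R -> 'rV[R]_3) i (e a t : R) : 0 < a ->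
  (forall s, - a <= s <= a -> C (- s) 0 i = e * C s 0 i) -> - a <= t <= a ->
  derivable C t 1 -> derivable C (- t) 1 ->
  derive1 C (- t) 0 i = - e * derive1 C t 0 i.
Proof.
move=> a0 Ce ta dC dCN.
have [dt dtE] := derive1_coord i dC; have [dNt dNtE] := derive1_coord i dCN.
by rewrite -dtE -dNtE; exact: (derive1_reflect a0 Ce ta dt dNt).
Qed.

(** Passing from a to -a turns c' = (x', 0, z') into (x', 0, -z') and c'' into (-x'', 0, z''). The
    normal (n_x, 0, n_z) becomes (-n_x, 0, n_z), provided its orientation does not flip, so both dot
    products in the curvature are unchanged. *)
Lemma curvature_reflect (I : set R) (x z : R -> R) (Nt : 'rV[R]_3 -> 'rV[R]_3)
    (a : R) :
  symmetric_curve I x z -> unit_normal_cylinder I x z Nt -> I a -> 0 < a ->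
  curvature x z Nt (- a) = curvature x z Nt a.
Proof.
move=> [itvI symI symC [U [_ IU] smC] regC _ _] [cNt unitNt] Ia a0.
have sub t : - a <= t <= a -> I t by move=> ta; exact: (itvI _ _ (symI _ Ia) Ia _ ta).
have subN t : - a <= t <= a -> - a <= - t <= a by lra.
have [C CE] : exists C, C = curve x z by eexists.
have [C1 C1d] : exists C1, C1 = derive1 C by eexists.
have [C2 C2d] : exists C2, C2 = derive1 C1 by eexists.
have C1E : C1 = 'D_1 C by apply/funext => t; rewrite C1d derive1E.
rewrite -CE in smC regC.
have dC t : - a <= t <= a -> derivable C t 1.
  by move=> /sub /IU; move=> /(smC [::]) /= /diff_derivable; apply.
have dC1 t : - a <= t <= a -> derivable C1 t 1.
  by rewrite C1E => /sub /IU /(smC [:: 1]) /= /diff_derivable; apply.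
have Nta : - a <= - a <= a by lra.
have taa : - a <= a <= a by lra.
(* Each differentiation reverses the parity [e] of a coordinate. *)
have refl1 i (e : R) : (forall t, - a <= t <= a -> C (- t) 0 i = e * C t 0 i) ->
    forall t, - a <= t <= a -> C1 (- t) 0 i = - e * C1 t 0 i.
  by move=> Ce t ta; rewrite C1d; apply: (derive1_coord_reflect a0) => //;
    apply: dC => //; exact: subN.
have refl2 i (e : R) : (forall t, - a <= t <= a -> C1 (- t) 0 i = e * C1 t 0 i) ->
    C2 (- a) 0 i = - e * C2 a 0 i.
  by move=> Ce; rewrite C2d; apply: (derive1_coord_reflect a0) => //; exact: dC1.
have x1N t : - a <= t <= a -> C1 (- t) 0 0 = 1 * C1 t 0 0.
  move=> ta; rewrite -[1]opprK; apply: refl1 => // s sa.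
  by rewrite CE /curve !vec3E mulN1r; have [] := symC s (sub _ sa).
have z1N t : - a <= t <= a -> C1 (- t) 0 2 = -1 * C1 t 0 2.
  move=> ta; apply: refl1 => // s sa.
  by rewrite CE /curve !vec3E mul1r; have [] := symC s (sub _ sa).
have y1 t : - a <= t <= a -> C1 t 0 1 = 0.
  move=> ta; have [_ yE] := derive1_coord 1 (dC _ ta); rewrite C1d -yE.
  have -> : (fun s => C s 0 1) = cst 0 by apply/funext => s; rewrite CE /curve vec3E.
  by rewrite derive1E derive_cst.
have x2N := refl2 _ _ x1N; have z2N := refl2 _ _ z1N.
(* The velocity has no y-component, so regularity amounts to x'^2 + z'^2 > 0. *)
have D0 t : - a <= t <= a -> 0 < C1 t 0 0 ^+ 2 + C1 t 0 2 ^+ 2.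
  move=> ta; rewrite lt0r addr_ge0 ?sqr_ge0// andbT paddr_eq0 ?sqr_ge0//.
  rewrite !sqrf_eq0; apply/negP => /andP[/eqP xt /eqP zt].
  move/eqP : (regC _ (sub _ ta)); rewrite -C1d; apply; apply/rowP => i; rewrite mxE.
  have := y1 t ta; case: i => -[|[|[|//]]] i yt.
  - by rewrite -[RHS]xt; congr (C1 t _ _); apply/val_inj.
  - by rewrite -[RHS]yt; congr (C1 t _ _); apply/val_inj.
  - by rewrite -[RHS]zt; congr (C1 t _ _); apply/val_inj.
pose n t := Nt (C t).
have nE t : - a <= t <= a -> [/\ n t 0 0 ^+ 2 + n t 0 2 ^+ 2 = 1, n t 0 1 = 0 &
    n t 0 0 * C1 t 0 0 + n t 0 2 * C1 t 0 2 = 0].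
  move=> ta; have := unitNt t 0 (sub _ ta).
  rewrite /cylinder_param scale0r addr0 -CE -/(n t) -C1d !dotE !vec3E => -[].
  rewrite !mulr0 mulr1 add0r addr0 => + + ny.
  by rewrite ny !mul0r !addr0 !expr2.
(* w^2 = |c'|^2 by Lagrange's identity, so w has constant sign: the normal does
not flip between c(-a) and c(a). *)
pose w t := n t 0 2 * C1 t 0 0 - n t 0 0 * C1 t 0 2.
have w2 t : - a <= t <= a -> w t ^+ 2 = C1 t 0 0 ^+ 2 + C1 t 0 2 ^+ 2.
  move=> /nE[n1 _ nC].
  transitivity ((n t 0 0 ^+ 2 + n t 0 2 ^+ 2) * (C1 t 0 0 ^+ 2 + C1 t 0 2 ^+ 2)
      - (n t 0 0 * C1 t 0 0 + n t 0 2 * C1 t 0 2) ^+ 2).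
    by rewrite /w; ring.
  by rewrite n1 nC; ring.
have wN : w (- a) = w a.
  apply: within_continuous_neq0_sqr_eq => //; first exact: ltW.
  - apply/subspace_continuousP => t ta; rewrite /= in_itv /= in ta.
    have cn i : n s 0 i @[s --> within `[- a, a] (nbhs t)] --> n t 0 i.
      apply: (@cvg_comp _ _ _ n (fun M => M 0 i) _ (nbhs (n t)));
        last exact: coord_continuous.
      have itvt : `[- a, a]%classic t by rewrite /= in_itv.
      have itvC s : `[- a, a]%classic s -> cylinder I x z (C s).
        rewrite /= in_itv/= => /sub Is; exists s => //; exists 0.
        by rewrite /cylinder_param scale0r addr0 CE.
      apply: (cvg_restrict_comp itvt itvC) => //.
      by apply/differentiable_continuous/derivable1_diffP/dC.
    have cC i : C1 s 0 i @[s --> within `[- a, a] (nbhs t)] --> C1 t 0 i.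
      have cC1 : {for t, continuous C1}.
        by apply/differentiable_continuous/derivable1_diffP/dC1.
      apply: cvg_within_filter.
      exact: (cvg_comp _ _ cC1 (@coord_continuous _ _ _ 0 i (C1 t))).
    by apply: cvgB; apply: cvgM.
  - by move=> t ta; rewrite -sqrf_eq0 w2// gt_eqF// D0.
  - by rewrite !w2// x1N// z1N//; ring.
(* The relations n . c' = 0 and n_z x' - n_x z' = w form a linear system for (n_x, n_z) with
   determinant x'^2 + z'^2 up to sign; it is solved here and in [nz]. *)
have nx t : - a <= t <= a ->
    n t 0 0 = - C1 t 0 2 * w t / (C1 t 0 0 ^+ 2 + C1 t 0 2 ^+ 2).
  move=> ta; have [_ _ nC] := nE t ta; apply: (canRL (mulfK _)).
    by rewrite gt_eqF// D0.
  transitivity (C1 t 0 0 * (n t 0 0 * C1 t 0 0 + n t 0 2 * C1 t 0 2)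
     - C1 t 0 2 * w t); first by rewrite /w; ring.
  by rewrite nC; ring.
have nz t : - a <= t <= a ->
    n t 0 2 = C1 t 0 0 * w t / (C1 t 0 0 ^+ 2 + C1 t 0 2 ^+ 2).
  move=> ta; have [_ _ nC] := nE t ta; apply: (canRL (mulfK _)).
    by rewrite gt_eqF// D0.
  transitivity (C1 t 0 2 * (n t 0 0 * C1 t 0 0 + n t 0 2 * C1 t 0 2)
     + C1 t 0 0 * w t); first by rewrite /w; ring.
  by rewrite nC; ring.
have [_ nyN _] := nE _ Nta; have [_ ny _] := nE _ taa.
(* As x' is even, z' is odd and [w] agrees at both ends, the formulas make n_x change sign and n_z
   keep its value. *)
have nxN : n (- a) 0 0 = - n a 0 0.
  by rewrite !nx// x1N// z1N// wN !mul1r !mulN1r sqrrN !mulNr.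
have nzN : n (- a) 0 2 = n a 0 2.
  by rewrite !nz// x1N// z1N// wN !mul1r !mulN1r sqrrN.
rewrite /curvature derive1nS derive1n1 -CE -C1d -C2d.
change (dot (C2 (- a)) (- n (- a)) / dot (C1 (- a)) (C1 (- a)) =
  dot (C2 a) (- n a) / dot (C1 a) (C1 a)).
have oppE (v : 'rV[R]_3) i : (- v) 0 i = - v 0 i by rewrite mxE.
rewrite !dotE !oppE nyN ny nxN nzN x2N z2N x1N// z1N// !y1//.
by congr (_ / _); ring.
Qed.

End CurvatureReflect.

(** * The quadratic form on separable functions *)

Section SeparableQ.
Context {R : realType}.
Implicit Types (f g : R -> R) (a b c d q : R).
Local Notation mu := (@lebesgue_measure R).

Lemma Rintegral_support (disp : measure_display) (T : measurableType disp)
    (m : {measure set T -> \bar R}) (A B : set T) (F : T -> R) :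
  A `<=` B -> (forall p, B p -> ~ A p -> F p = 0) ->
  \int[m]_(p in B) F p = \int[m]_(p in A) F p.
Proof.
move=> AB F0; rewrite Rintegral_mkcond [RHS]Rintegral_mkcond.
congr (Rintegral _ _ _); apply/funext => p; rewrite !patchE.
case: (boolP (p \in B)) => [/set_mem Bp|pB]; case: (boolP (p \in A)) => // pA.
  by apply: F0 => //; move/mem_set; exact/negP.
by move/negP: pB; case; apply/mem_set/AB/set_mem.
Qed.

Lemma rect_itv (s0 : R) c d : rect s0 `[c, d] = `[- s0, s0] `*` `[c, d].
Proof.
by apply/seteqP; split=> -[u v] /=; rewrite !in_itv.
Qed.

Lemma continuous_sqr f : continuous f -> continuous (fun t => f t ^+ 2).
Proof. by move=> cf t; apply: cvgM; exact: cf. Qed.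

Lemma Dirichlet_sep f g a b c d : smooth_line f -> smooth_line g ->
  let u p := f p.1 * g p.2 in
  \int[area]_(p in `[a, b] `*` `[c, d]) ('D_e1 u p ^+ 2 + 'D_e2 u p ^+ 2) =
  (\int[mu]_(t in `[a, b]) derive1 f t ^+ 2) * \int[mu]_(t in `[c, d]) g t ^+ 2
  + (\int[mu]_(t in `[a, b]) f t ^+ 2) * \int[mu]_(t in `[c, d]) derive1 g t ^+ 2.
Proof.
move=> sf sg u.
have cf := continuous_sqr (smooth_line_continuous sf).
have cg := continuous_sqr (smooth_line_continuous sg).
have cf' := continuous_sqr (smooth_line_continuous (smooth_line_derive sf)).
have cg' := continuous_sqr (smooth_line_continuous (smooth_line_derive sg)).
have i1 := @integrable_prod _ _ _ a b c d cf' cg.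
have i2 := @integrable_prod _ _ _ a b c d cf cg'.
rewrite -!Rintegral_prod// -RintegralD //; last exact: measurableX.
apply: eq_Rintegral => p _.
by rewrite !derive_sep// /e1 /e2 /= !mul1r !mul0r addr0 add0r !exprMn.
Qed.

(** Flatness removes both |A|^2 and the conormal term of the Robin coefficient; equality of the
    curvatures at the two contact points leaves the same constant on both sides. *)
Lemma QformE (x z : R -> R) (s0 c t0 gamma : R) N Nt J (u : R * R -> R) :
  curvature x z Nt (- t0) = curvature x z Nt t0 ->
  let q := curvature x z Nt t0 / sin gamma in
  Qform x z s0 c t0 gamma N Nt J u =
  \int[area]_(p in rect s0 J) ('D_e1 u p ^+ 2 + 'D_e2 u p ^+ 2)
  - (\int[mu]_(y in J) (q * u (s0, y) ^+ 2)
     + \int[mu]_(y in J) (q * u (- s0, y) ^+ 2)).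
Proof.
move=> kN q; rewrite /Qform; congr (_ - (_ + _)); apply: eq_Rintegral => p _.
- by rewrite sff_norm2_plane mul0r subr0.
- by rewrite /robin sff_plane mulr0 addr0 mul1r.
- by rewrite /robin sff_plane mulr0 addr0 mulN1r kN.
Qed.

Lemma Qform_sep (x z : R -> R) (s0 c t0 gamma : R) N Nt c1 d1 f g :
  smooth_line f -> smooth_line g ->
  curvature x z Nt (- t0) = curvature x z Nt t0 ->
  let q := curvature x z Nt t0 / sin gamma in
  Qform x z s0 c t0 gamma N Nt `[c1, d1] (fun p => f p.1 * g p.2) =
  (\int[mu]_(t in `[- s0, s0]) derive1 f t ^+ 2) * \int[mu]_(t in `[c1, d1]) g t ^+ 2
  + (\int[mu]_(t in `[- s0, s0]) f t ^+ 2) * \int[mu]_(t in `[c1, d1]) derive1 g t ^+ 2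
  - q * (f s0 ^+ 2 + f (- s0) ^+ 2) * \int[mu]_(t in `[c1, d1]) g t ^+ 2.
Proof.
move=> sf sg kN q; rewrite QformE// rect_itv Dirichlet_sep//; congr (_ - _).
have side s : \int[mu]_(y in `[c1, d1]) (q * (f s * g y) ^+ 2) =
    q * f s ^+ 2 * \int[mu]_(t in `[c1, d1]) g t ^+ 2.
  rewrite -RintegralZl//; last first.
    by apply/continuous_integrable_itv/continuous_sqr/smooth_line_continuous.
  by apply: eq_Rintegral => y _; rewrite exprMn mulrA.
by rewrite !side mulrDr mulrDl.
Qed.

End SeparableQ.

(** * The equation for beta *)

Section ContactRate.
Context {R : realType}.
Implicit Types (q b : R).

Lemma contact_rate_eq (k sg s0 b : R) : 0 < k -> 0 < sg -> k / sg < b ->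
  expR (4 * b * s0) = ((b * sg + k) / (b * sg - k)) ^+ 2 <->
  expR (2 * b * s0) * (b - k / sg) = b + k / sg.
Proof.
move=> k0 sg0 kb; have q0 : 0 < k / sg by rewrite divr_gt0.
have bq : 0 < b - k / sg by rewrite subr_gt0.
have -> : 4 * b * s0 = 2 * b * s0 + 2 * b * s0 by ring.
have -> : (b * sg + k) / (b * sg - k) = (b + k / sg) / (b - k / sg).
  have bk : 0 < b * sg - k by rewrite subr_gt0 -ltr_pdivrMr.
  field; rewrite !gt_eqF//.
rewrite expRD -expr2; split=> [/eqP|<-]; last first.
  by rewrite mulfK// gt_eqF.
rewrite eqrXn2 ?expR_ge0//; last by rewrite divr_ge0; lra.
by move=> /eqP ->; rewrite mulfVK// gt_eqF.
Qed.

Lemma contact_rate_exists q (s0 : R) : 0 < q -> 0 < s0 ->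
  exists2 b, q < b & expR (2 * b * s0) * (b - q) = b + q.
Proof.
move=> q0 s00; pose F (b : R) := expR (2 * b * s0) * (b - q) - (b + q).
have F0 : F q < 0 by rewrite /F subrr mulr0; lra.
(* At b = q + 1/s0 one has e^(2 b s0) >= 1 + 2 b s0 = 3 + 2 q s0, so the product is at least 3/s0 +
   2q, which exceeds b + q = 2q + 1/s0. *)
have F1 : 0 <= F (q + s0^-1).
  have := expR_ge1Dx (2 * (q + s0^-1) * s0).
  have s1 : s0^-1 * s0 = 1 by rewrite mulVf ?gt_eqF.
  have sV : 0 < s0^-1 by rewrite invr_gt0.
  rewrite /F; set e := expR _; nra.
have cF : continuous F.
  have cE := smooth_line_continuous
    (@smooth_line_affine _ _ (2 * s0) 0 (@smooth_line_expR R)).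
  have -> : F = fun b => expR (2 * s0 * b + 0) * (b - q) - (b + q).
    by apply/funext => b; rewrite /F addr0 mulrAC.
  move=> b; apply: cvgB; last by apply: cvgD; [exact: cvg_id|exact: cvg_cst].
  apply: cvgM; first exact: cE.
  by apply: cvgB; [exact: cvg_id|exact: cvg_cst].
have [b] : exists2 b, b \in `[q, q + s0^-1]%R & F b = 0.
  apply: IVT; first by rewrite lerDl invr_ge0 ltW.
    exact: continuous_subspaceT.
  by rewrite ge_min le_max F1 (ltW F0) orbT.
rewrite in_itv/= => /andP[qb _] Fb; exists b.
  by rewrite lt_neqAle qb andbT; apply/eqP => qE; move: Fb F0; rewrite -qE; lra.
by move/eqP: Fb; rewrite subr_eq0 => /eqP.
Qed.

(** On (q, oo) the exponential increases in b while (b + q) / (b - q) decreases, so they agree at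
    most once. *)
Lemma contact_rate_le q (s0 : R) b b' : 0 < q -> 0 < s0 -> q < b -> b < b' ->
  expR (2 * b * s0) * (b - q) = b + q ->
  expR (2 * b' * s0) * (b' - q) = b' + q -> False.
Proof.
move=> q0 s00 qb bb' hb hb'.
have : expR (2 * b * s0) < expR (2 * b' * s0) by rewrite ltr_expR; nra.
move: hb hb'; set e := expR _; set e' := expR _ => hb hb' ee'.
have : 0 < (b' - q) * (b - q) * (e' - e) by rewrite !mulr_gt0 ?subr_gt0//; lra.
(* After substituting both equations the right side is (b' + q)(b - q) - (b + q)(b' - q) = 2 q (b -
   b'), which is negative. *)
have -> : (b' - q) * (b - q) * (e' - e) =
    e' * (b' - q) * (b - q) - e * (b - q) * (b' - q) by ring.
by rewrite hb hb'; nra.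
Qed.

End ContactRate.

(** * One-dimensional energy integrals *)

Section Energy.
Context {R : realType}.
Implicit Types (f g : R -> R) (a b k : R).
Local Notation mu := (@lebesgue_measure R).

(** If f'' = k f then (f f')' = f'^2 + k f^2. It serves with a positive constant for the cosh
    profile and a negative one for the sine profile. *)
Lemma energy_identity f k a b : smooth_line f -> a < b ->
  (forall t, derive1 (derive1 f) t = k * f t) ->
  \int[mu]_(t in `[a, b]) derive1 f t ^+ 2
    + k * \int[mu]_(t in `[a, b]) f t ^+ 2 =
  f b * derive1 f b - f a * derive1 f a.
Proof.
move=> sf ab f2; have sf' := smooth_line_derive sf.
have cf := continuous_sqr (smooth_line_continuous sf).
have cf' := continuous_sqr (smooth_line_continuous sf').
rewrite -RintegralZl//; last exact: continuous_integrable_itv.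
rewrite -RintegralD//; last 2 first.
- exact: continuous_integrable_itv.
- by apply: continuous_integrable_itv => t; apply: cvgMr; exact: cf.
have dF t : is_derive t (1 : R) (f * derive1 f) (derive1 f t ^+ 2 + k * f t ^+ 2).
  have df := smooth_line_is_derive t sf; have df' := smooth_line_is_derive t sf'.
  by apply: (is_derive_eq (is_deriveM df df')); rewrite !regular_scaleE f2; ring.
apply: (Rintegral_FTC ab _ dF).
by move=> t; apply: cvgD; [exact: cf'|apply: cvgMr; exact: cf].
Qed.

Lemma Rintegral_itv_cst (r : R) a b : a < b ->
  \int[mu]_(t in `[a, b]) r = r * (b - a).
Proof.
move=> ab; have dF t : is_derive t (1 : R) (fun t => r * t) (cst r t).
  by apply: is_derive_eq; rewrite regular_scaleE mulr1.
by rewrite (Rintegral_FTC ab _ dF) ?mulrBr// => t; exact: cvg_cst.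
Qed.

Lemma le_Rintegral_itv f g a b : continuous f -> continuous g ->
  (forall t, a <= t <= b -> f t <= g t) ->
  \int[mu]_(t in `[a, b]) f t <= \int[mu]_(t in `[a, b]) g t.
Proof.
move=> cf cg fg; apply: le_Rintegral => //; exact: continuous_integrable_itv.
Qed.

Lemma smooth_line_scale f k : smooth_line f -> smooth_line (fun t => f (k * t)).
Proof.
move=> sf; have -> : (fun t => f (k * t)) = fun t => f (k * t + 0).
  by apply/funext => t; rewrite addr0.
exact: smooth_line_affine.
Qed.

Lemma derive1_scale f k t : smooth_line f ->
  derive1 (fun t => f (k * t)) t = k * derive1 f (k * t).
Proof.
move=> sf; have df := smooth_line_is_derive (k * t) sf.
have dk : is_derive t (1 : R) (fun t => k * t) k.
  by apply: is_derive_eq; rewrite regular_scaleE mulr1.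
rewrite derive1E mulrC.
exact: (@derive_val _ _ _ _ _ _ _ (is_derive1_comp df dk)).
Qed.

End Energy.

(** * The cosh and sine profiles *)

Section CoshSin.
Context {R : realType}.
Local Notation mu := (@lebesgue_measure R).

Definition cosh2 (b t : R) : R := expR (b * t) + expR (- b * t).

Lemma smooth_line_cosh2 b : smooth_line (cosh2 b).
Proof. by apply: smooth_lineD; apply: smooth_line_scale; exact: smooth_line_expR. Qed.

Lemma derive1_expR_scale (b t : R) :
  derive1 (fun t => expR (b * t)) t = b * expR (b * t).
Proof.
rewrite derive1_scale; last exact: smooth_line_expR.
by rewrite derive1E derive_val.
Qed.

Lemma derive1_cosh2 b t :
  derive1 (cosh2 b) t = b * (expR (b * t) - expR (- b * t)).
Proof.
have sE k : smooth_line (fun t : R => expR (k * t)).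
  exact: smooth_line_scale smooth_line_expR.
rewrite derive1E deriveD -?derive1E ?derive1_expR_scale; last 2 first.
- exact: (sE b 0%N).
- exact: (sE (- b) 0%N).
by ring.
Qed.

Lemma derive2_cosh2 b t : derive1 (derive1 (cosh2 b)) t = b ^+ 2 * cosh2 b t.
Proof.
have sE k : smooth_line (fun t : R => expR (k * t)).
  exact: smooth_line_scale smooth_line_expR.
have -> : derive1 (cosh2 b) = b *: ((fun t => expR (b * t)) - (fun t => expR (- b * t))).
  by apply/funext => s; rewrite derive1_cosh2.
rewrite derive1E deriveZ ?deriveB -?derive1E ?derive1_expR_scale.
- by rewrite regular_scaleE /cosh2; ring.
- exact: (sE b 0%N).
- exact: (sE (- b) 0%N).
- by apply: derivableB; [exact: (sE b 0%N)|exact: (sE (- b) 0%N)].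
Qed.

(** Adding e^s >= 1 + s and e^(-s) >= 1 - s even gives 2. The bound serves to make the integral of
    the squared profile strictly positive. *)
Lemma cosh2_ge1 b t : 1 <= cosh2 b t.
Proof.
have := expR_ge1Dx (b * t); have := expR_ge1Dx (- (b * t)).
by rewrite /cosh2 mulNr; lra.
Qed.

Lemma cosh2N b t : cosh2 b (- t) = cosh2 b t.
Proof. by rewrite /cosh2 mulrNN mulrN mulNr addrC. Qed.

Lemma derive1_cosh2N b t : derive1 (cosh2 b) (- t) = - derive1 (cosh2 b) t.
Proof. by rewrite !derive1_cosh2 mulrNN (mulrN b t) (mulNr b t); ring. Qed.

(** Multiplying the hypothesis by e^(-b t) and regrouping gives b (e^(b t) - e^(-b t)) = q (e^(b t)
    + e^(-b t)): the equation for beta is the Robin condition f' = q f. *)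
Lemma derive1_cosh2_contact b q t : expR (2 * b * t) * (b - q) = b + q ->
  derive1 (cosh2 b) t = q * cosh2 b t.
Proof.
rewrite derive1_cosh2 /cosh2; have := expR_gt0 (b * t).
have -> : 2 * b * t = b * t + b * t by ring.
rewrite expRD mulNr expRN; set e := expR _ => e0 eE.
have ee : e * e^-1 = 1 by rewrite mulfV// gt_eqF.
apply: (@mulfI _ e); first by rewrite gt_eqF.
transitivity (b * (e * e - e * e^-1)); first by ring.
transitivity (q * (e * e + e * e^-1)); last by ring.
by rewrite ee; move: (e * e) eE => E eE; lra.
Qed.

Definition sin_scale (k t : R) : R := sin (k * t).

Lemma smooth_line_sin_scale k : smooth_line (sin_scale k).
Proof. exact: smooth_line_scale smooth_line_sin. Qed.

Lemma derive2_sin_scale k t :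
  derive1 (derive1 (sin_scale k)) t = - k ^+ 2 * sin_scale k t.
Proof.
have ds : derive1 sin = cos :> (R -> R).
  by apply/funext => s; rewrite derive1E derive_val.
have -> : derive1 (sin_scale k) = k *: (fun t => cos (k * t)).
  apply/funext => s; rewrite derive1_scale; last exact: smooth_line_sin.
  by rewrite ds.
have sc : smooth_line (@cos R) by rewrite -ds; exact: smooth_line_derive smooth_line_sin.
have dc : derivable (fun t => cos (k * t)) t 1 := @smooth_line_scale _ _ k sc 0%N t.
rewrite derive1E deriveZ// -derive1E.
rewrite derive1_scale// derive1E derive_val regular_scaleE /sin_scale; ring.
Qed.

Lemma Rintegral_sin_sqr (k h : R) : 0 < k -> 0 < h -> sin (k * h) = 0 ->
  \int[mu]_(t in `[0, h]) sin_scale k t ^+ 2 = h / 2.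
Proof.
move=> k0 h0 skh; pose G := sin_scale k.
have sG : smooth_line G := @smooth_line_sin_scale k.
have sG' := smooth_line_derive sG.
(* This primitive is t/2 - sin(2 k t)/(4 k), written with G G' so that the boundary terms vanish
   with [G]. *)
pose F (t : R) := 2^-1 * t - (2 * k ^+ 2)^-1 * (G t * derive1 G t).
have dF t : is_derive t (1 : R) F (G t ^+ 2).
  have dG := smooth_line_is_derive t sG; have dG' := smooth_line_is_derive t sG'.
  apply: is_derive_eq.
  rewrite !regular_scaleE derive2_sin_scale.
  have -> : derive1 G t = k * cos (k * t).
    rewrite derive1_scale; last exact: smooth_line_sin.
    by rewrite derive1E derive_val.
  have := cos2Dsin2 (k * t); rewrite -/(sin_scale k t) -/(G t).
  move: (cos _) (G t) => C S CS.
  have -> : k * C * (k * C) = k ^+ 2 * (1 - S ^+ 2) by rewrite -CS; ring.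
  by field; exact: lt0r_neq0.
rewrite (Rintegral_FTC h0 _ dF).
- have G0 : G 0 = 0 by rewrite /G /sin_scale mulr0 sin0.
  by rewrite /F G0 [G h]skh !mul0r !mulr0 !subr0 mulrC.
- exact: continuous_sqr (smooth_line_continuous sG).
Qed.

Lemma Rintegral_sin (k h : R) : 0 < k -> 0 < h -> cos (k * h) = 1 ->
  \int[mu]_(t in `[0, h]) sin_scale k t = 0.
Proof.
move=> k0 h0 ckh; pose F t := - k ^-1 * cos (k * t).
have dF t : is_derive t (1 : R) F (sin_scale k t).
  have dk : is_derive t (1 : R) (fun t => k * t) k.
    by apply: is_derive_eq; rewrite regular_scaleE mulr1.
  have dc := is_derive1_comp (is_derive_cos (k * t)) dk.
  apply: (is_derive_eq (is_deriveZ (- k^-1) dc)).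
  by rewrite regular_scaleE /sin_scale; field; exact: lt0r_neq0.
rewrite (Rintegral_FTC h0 _ dF).
  by rewrite /F ckh mulr0 cos0 subrr.
exact: smooth_line_continuous (@smooth_line_sin_scale k).
Qed.

End CoshSin.

(** * Destabilizing functions *)

Section Instability.
Context {R : realType}.
Local Notation mu := (@lebesgue_measure R).

Lemma Rintegral_itv_subset (f : R -> R) (a b d : R) : continuous f ->
  (forall t, 0 <= f t) -> b <= d ->
  \int[mu]_(t in `[a, b]) f t <= \int[mu]_(t in `[a, d]) f t.
Proof.
move=> cf f0 bd; apply: fine_le.
- by apply: integrable_fin_num => //; exact: continuous_integrable_itv.
- by apply: integrable_fin_num => //; exact: continuous_integrable_itv.
apply: ge0_subset_integral => //.
- by have /integrableP[] := continuous_integrable_itv a d cf.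
- by move=> t _; rewrite lee_fin.
- by apply: subset_itvl; rewrite bnd_simp.
Qed.

(** Here [F], [F'], [G], [G'] stand for the integrals of f^2, f'^2, g^2, g'^2, and [fs] for f(s0).
    The two energy identities give G' = k^2 G and F' = 2 q fs^2 - b^2 F; the boundary term cancels
    and (k^2 - b^2) F G remains. *)
Lemma separable_form_lt0 (F F' G G' k b q fs : R) : 0 < F -> 0 < G ->
  k < b -> 0 < k -> G' + - k ^+ 2 * G = 0 ->
  F' + b ^+ 2 * F = fs * (q * fs) - fs * - (q * fs) ->
  F' * G + F * G' - q * (fs ^+ 2 + fs ^+ 2) * G < 0.
Proof.
move=> F0 G0 kb k0 eG eF.
have -> : G' = k ^+ 2 * G by lra.
have -> : F' = 2 * q * fs ^+ 2 - b ^+ 2 * F.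
  by rewrite -[F'](addrK (b ^+ 2 * F)) eF; ring.
have -> : (2 * q * fs ^+ 2 - b ^+ 2 * F) * G + F * (k ^+ 2 * G) -
    q * (fs ^+ 2 + fs ^+ 2) * G = - ((b - k) * (b + k) * F * G) by ring.
rewrite oppr_lt0 !mulr_gt0//; lra.
Qed.

Lemma piece_unstable (x z : R -> R) (s0 c t0 gamma : R)
    (N : R * R -> 'rV[R]_3) (Nt : 'rV[R]_3 -> 'rV[R]_3) (b h : R) :
  0 < s0 -> curvature x z Nt (- t0) = curvature x z Nt t0 ->
  let q := curvature x z Nt t0 / sin gamma in
  0 < q -> q < b ->
  expR (2 * b * s0) * (b - q) = b + q -> 2 * pi / b < h ->
  ~ piece_stable x z s0 c t0 gamma N Nt h.
Proof.
move=> s0_gt0 curvN.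
have QE d1 g f (sf : smooth_line f) (sg : smooth_line g) :=
  Qform_sep s0 c gamma N 0 d1 sf sg curvN.
move: QE => /=; move: (_ / sin gamma) => q; clear curvN.
move=> QE q_gt0 qb bE bh; have b0 : 0 < b by exact: lt_trans qb.
have pi0 := @pi_gt0 R.
have h0 : 0 < h by apply: lt_trans bh; rewrite divr_gt0// mulr_gt0.
(* One full period fits in [0, h]: the sine vanishes at both ends and has mean zero, and k < b is
   equivalent to h > 2 pi / b. *)
pose k : R := 2 * pi / h; have k0 : 0 < k by rewrite divr_gt0// mulr_gt0.
have kb : k < b by rewrite ltr_pdivrMr// -ltr_pdivrMl// mulrC.
have kh : k * h = pi *+ 2 by rewrite /k mulfVK ?gt_eqF// mulr2n; ring.
pose f := cosh2 b; pose g := sin_scale k.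
have sf : smooth_line f by exact: smooth_line_cosh2.
have sg : smooth_line g by exact: smooth_line_sin_scale.
have cf := smooth_line_continuous sf; have cg := smooth_line_continuous sg.
have skh : sin (k * h) = 0 by rewrite kh sin2pi.
have g0 : g 0 = 0 by rewrite /g /sin_scale mulr0 sin0.
move=> /(_ (fun p => f p.1 * g p.2)) st.
suff /negP : ~~ (0 <= Qform x z s0 c t0 gamma N Nt `[0, h] (fun p => f p.1 * g p.2)).
  apply; apply: st.
    split; first by apply: sep_smooth_on; exact: sep_smoothM.
    by move=> a _ /=; rewrite g0 [g h]skh mulr0.
  by rewrite rect_itv Rintegral_prod// Rintegral_sin ?mulr0// kh cos2pi.
rewrite -ltNge QE//.
have eg := energy_identity sg h0 (derive2_sin_scale k).
have s0N : - s0 < s0 by rewrite gtrN.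
have ef := energy_identity sf s0N (derive2_cosh2 b).
have fN : f (- s0) = f s0 by exact: cosh2N.
have f'N : derive1 f (- s0) = - derive1 f s0 by exact: derive1_cosh2N.
have f's0 : derive1 f s0 = q * f s0 by exact: derive1_cosh2_contact.
have If : 0 < \int[mu]_(t in `[- s0, s0]) f t ^+ 2.
  apply: (@lt_le_trans _ _ (1 * (s0 - - s0))).
    by rewrite mul1r subr_gt0.
  rewrite -(Rintegral_itv_cst 1 s0N); apply: le_Rintegral_itv.
  - by move=> t; exact: cvg_cst.
  - exact: continuous_sqr.
  - by move=> t _; apply/exprn_ege1/cosh2_ge1.
have Ig : 0 < \int[mu]_(t in `[0, h]) g t ^+ 2.
  by rewrite Rintegral_sin_sqr// divr_gt0.
move: eg; rewrite g0 [g h]skh !mul0r subr0 => eg.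
move: ef; rewrite f'N fN f's0 => ef.
move: If Ig eg ef; rewrite ?fN.
move: (\int[mu]_(t in `[- s0, s0]) f t ^+ 2) (\int[mu]_(t in `[0, h]) g t ^+ 2).
move: (\int[mu]_(t in `[- s0, s0]) _ t ^+ 2) (\int[mu]_(t in `[0, h]) _ t ^+ 2).
move: (f s0) => fs F' G' F G If Ig eg ef.
exact: (separable_form_lt0 If Ig kb k0 eg ef).
Qed.

(** At |t| = 1 the function vanishes on one side only, so a unit interval pointing away from the
    origin is used. *)
Lemma derive1_support (f : R -> R) : smooth_line f ->
  (forall t, 1 <= `|t| -> f t = 0) -> forall t, 1 <= `|t| -> derive1 f t = 0.
Proof.
move=> sf f0 t; rewrite ler_normr => /orP[] t1.
  apply: (@derive1_vanish _ _ t (t + 1)); [lra| |lra|exact: (sf 0%N)].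
  by move=> s ts; apply: f0; rewrite ler_normr; apply/orP; left; lra.
apply: (@derive1_vanish _ _ (t - 1) t); [lra| |lra|exact: (sf 0%N)].
by move=> s ts; apply: f0; rewrite ler_normr; apply/orP; right; lra.
Qed.

Lemma rect_setT_sub (s0 L : R) : rect s0 `[- L, L] `<=` rect s0 setT.
Proof. by move=> p []. Qed.

Lemma notin_itv_norm (L y : R) : ~ `[- L, L]%classic y -> L <= `|y|.
Proof.
move=> ny; rewrite leNgt; apply/negP => /ltW.
by rewrite ler_norml => yL; apply: ny; rewrite /= in_itv.
Qed.

Lemma rect_setT_out (s0 L : R) (p : R * R) :
  rect s0 setT p -> ~ rect s0 `[- L, L] p -> L <= `|p.2|.
Proof. by move=> [p1 _] np; apply: notin_itv_norm => pL; apply: np. Qed.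

Lemma Rintegral_strip_support (s0 L : R) (F : R * R -> R) :
  (forall p, L <= `|p.2| -> F p = 0) ->
  \int[area]_(p in rect s0 setT) F p = \int[area]_(p in rect s0 `[- L, L]) F p.
Proof.
move=> F0; apply: Rintegral_support; first exact: rect_setT_sub.
by move=> p Bp /(rect_setT_out Bp)/F0.
Qed.

(** Both g and g' vanish for |y| >= L, hence so do all integrands; this reduces the infinite strip
    to a rectangle, where the product formulas hold. *)
Lemma Qform_sep_support (x z : R -> R) (s0 c t0 gamma : R)
    (N : R * R -> 'rV[R]_3) (Nt : 'rV[R]_3 -> 'rV[R]_3) (L : R) (f g : R -> R) :
  smooth_line f -> smooth_line g ->
  curvature x z Nt (- t0) = curvature x z Nt t0 ->
  (forall t, L <= `|t| -> g t = 0) -> (forall t, L <= `|t| -> derive1 g t = 0) ->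
  Qform x z s0 c t0 gamma N Nt setT (fun p => f p.1 * g p.2) =
  Qform x z s0 c t0 gamma N Nt `[- L, L] (fun p => f p.1 * g p.2).
Proof.
move=> sf sg curvN g0 g'0; rewrite !(QformE s0 c gamma N _ _ curvN); clear curvN.
rewrite (@Rintegral_strip_support s0 L); last first.
  move=> p pL; rewrite !derive_sep// g0// g'0//.
  by rewrite !mulr0 !addr0 expr0n addr0.
by congr (_ - (_ + _)); apply: Rintegral_support => // y _ /notin_itv_norm /g0 gy;
  rewrite /= gy mulr0 expr0n mulr0.
Qed.

Lemma strip_unstable (x z : R -> R) (s0 c t0 gamma : R)
    (N : R * R -> 'rV[R]_3) (Nt : 'rV[R]_3 -> 'rV[R]_3) :
  0 < s0 -> curvature x z Nt (- t0) = curvature x z Nt t0 ->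
  0 < curvature x z Nt t0 / sin gamma ->
  ~ strip_stable x z s0 c t0 gamma N Nt.
Proof.
move=> s0_gt0 curvN.
have QE L g f (sf : smooth_line f) (sg : smooth_line g) :=
  Qform_sep s0 c gamma N (- L) L sf sg curvN.
have QT L g f (sf : smooth_line f) (sg : smooth_line g) :=
  @Qform_sep_support x z s0 c t0 gamma N Nt L f g sf sg curvN.
move: QE QT => /=; move: (_ / sin gamma) => q; clear curvN.
move=> QE QT q_gt0.
have [b [sb b1 b0]] := @exists_bump R.
pose phi := derive1 b.
have sphi : smooth_line phi by exact: smooth_line_derive.
have sphi' := smooth_line_derive sphi.
have phi1 := derive1_support sb b1; have phi'1 := derive1_support sphi phi1.
have [M M0 phiM] : exists2 M, 0 <= M & forall t, derive1 phi t ^+ 2 <= M.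
  have [||m _ hm] := @EVT_max R (fun t => derive1 phi t ^+ 2) (-1) 1.
  - by lra.
  - by apply: continuous_subspaceT; apply/continuous_sqr/smooth_line_continuous.
  exists (derive1 phi m ^+ 2); first exact: sqr_ge0.
  move=> t; have [t1|/ltW t1] := leP `|t| 1.
    by apply: hm; rewrite in_itv/= -ler_norml.
  by rewrite phi'1// expr0n sqr_ge0.
(* Chosen so that q b(0)^2 L = q b(0)^2 + 2 s0 M > 2 s0 M; as L >= 1, the final comparison
   follows. *)
pose L := 1 + 2 * s0 * M / (q * b 0 ^+ 2).
have L1 : 1 <= L.
  by rewrite lerDl divr_ge0 ?(mulr_ge0 _ M0) ?(mulr_ge0 (ltW q_gt0)) ?sqr_ge0//
    mulr_ge0 ?ltW.
have L0 : 0 < L by lra.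
pose g t := phi (L^-1 * t).
have sg : smooth_line g by exact: smooth_line_scale.
have cg := smooth_line_continuous sg.
have Lt t : L <= `|t| -> 1 <= `|L^-1 * t|.
  by rewrite normrM gtr0_norm ?invr_gt0// mulrC ler_pdivlMr// mul1r.
have g0 t : L <= `|t| -> g t = 0 by move=> /Lt /phi1.
have g'E t : derive1 g t = L^-1 * derive1 phi (L^-1 * t).
  by rewrite derive1_scale.
have g'0 t : L <= `|t| -> derive1 g t = 0.
  by move=> /Lt /phi'1 E; rewrite g'E E mulr0.
pose one : R -> R := cst 1.
have sone : smooth_line one by exact: smooth_line_cst.
pose u (p : R * R) := one p.1 * g p.2.
have LN : - L < L by lra.
(* This primitive vanishes at both ends of [-L, L], which gives mean zero, and equals L b(0) at
   0. *)
have dG t : is_derive t (1 : R) (fun t => L * b (L^-1 * t)) (g t).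
  have dk : is_derive t (1 : R) (fun t => L^-1 * t) L^-1.
    by apply: is_derive_eq; rewrite regular_scaleE mulr1.
  have db := is_derive1_comp (smooth_line_is_derive (L^-1 * t) sb) dk.
  apply: (is_derive_eq (is_deriveZ L db)).
  by rewrite regular_scaleE mulrCA mulfV ?gt_eqF// mulr1.
have Lb t : L <= `|t| -> b (L^-1 * t) = 0 by move=> /Lt /b1.
have nL : `|L| = L by rewrite gtr0_norm.
have Ig : \int[mu]_(t in `[- L, L]) g t = 0.
  rewrite (Rintegral_FTC LN cg dG) !Lb ?normrN ?nL//.
  by rewrite !mulr0 subrr.
have Ig2 : b 0 ^+ 2 * L <= \int[mu]_(t in `[- L, L]) g t ^+ 2.
  (* Only the half [-L, 0] is kept: over the whole interval the integral of g is zero and the linear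
     lower bound for g^2 would be negative. *)
  have LN0 : - L < 0 by rewrite oppr_lt0.
  apply: le_trans (Rintegral_itv_subset (- L) (continuous_sqr cg)
    (fun t => sqr_ge0 _) (ltW L0)).
  pose w (t : R) := 2 * b 0 * g t - b 0 ^+ 2.
  have cw : continuous w.
    by move=> t; apply: cvgB; [apply: cvgMr; exact: cg|exact: cvg_cst].
  pose W (t : R) := 2 * b 0 * (L * b (L^-1 * t)) - b 0 ^+ 2 * t.
  have dW t : is_derive t (1 : R) W (w t).
    have d1 := is_deriveZ (2 * b 0) (dG t).
    have d2 : is_derive t (1 : R) (fun t => b 0 ^+ 2 * t) (b 0 ^+ 2).
      by apply: is_derive_eq; rewrite regular_scaleE mulr1.
    exact: (is_deriveB d1 d2).
  have <- : \int[mu]_(t in `[- L, 0]) w t = b 0 ^+ 2 * L.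
    by rewrite (Rintegral_FTC LN0 cw dW) /W (Lb (- L)) ?normrN ?nL// !mulr0; ring.
  apply: le_Rintegral_itv => //; first exact: continuous_sqr.
  by move=> t _; rewrite /w; have := sqr_ge0 (g t - b 0); nra.
(* The scaling contributes a factor 1/L^2 to the integrand, and the interval has length 2 L. *)
have Ig'2 : \int[mu]_(t in `[- L, L]) derive1 g t ^+ 2 <= 2 * M / L.
  have -> : 2 * M / L = \int[mu]_(t in `[- L, L]) (L^-1 ^+ 2 * M).
    by rewrite Rintegral_itv_cst//; field; rewrite gt_eqF.
  apply: le_Rintegral_itv.
  - exact/continuous_sqr/smooth_line_continuous/smooth_line_derive.
  - by move=> t; exact: cvg_cst.
  - by move=> t _; rewrite g'E exprMn ler_wpM2l ?sqr_ge0.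
move=> /(_ u) st.
suff /negP : ~~ (0 <= Qform x z s0 c t0 gamma N Nt setT u).
  apply; apply: st.
    split; first by apply: sep_smooth_on; exact: sep_smoothM.
    have cR : compact (`[- s0, s0] `*` `[- L, L] : set (R * R)).
      by apply: compact_setX; exact: segment_compact.
    apply: (subclosed_compact _ cR); first exact: closed_closure.
    rewrite -rect_itv; have clR : closed (rect s0 `[- L, L]).
      rewrite rect_itv; apply: compact_closed => //; exact: norm_hausdorff.
    rewrite ((closure_id _).1 clR); apply: closureS => p [Bp /= up].
    apply: contrapT => /(rect_setT_out Bp) /g0 gp.
    by move: up; rewrite /u gp mulr0 eqxx.
  rewrite (@Rintegral_strip_support s0 L).
    rewrite rect_itv Rintegral_prod ?Ig ?mulr0//.
    exact: smooth_line_continuous.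
  by move=> p /g0 gp; rewrite /u /= gp mulr0.
rewrite (QT L)// -ltNge QE//.
have sN : - s0 < s0 by rewrite gtrN.
have -> : \int[mu]_(t in `[- s0, s0]) derive1 one t ^+ 2 = 0.
  rewrite -[RHS](mul0r (s0 - - s0)) -(Rintegral_itv_cst 0 sN).
  by apply: eq_Rintegral => t _; rewrite derive1_cst expr0n.
have -> : \int[mu]_(t in `[- s0, s0]) one t ^+ 2 = 2 * s0.
  transitivity (1 * (s0 - - s0)); last by ring.
  rewrite -(Rintegral_itv_cst 1 sN).
  by apply: eq_Rintegral => t _; rewrite /one /= expr1n.
move: Ig2 Ig'2; set G := \int[mu]_(t in _) g t ^+ 2.
set G' := \int[mu]_(t in _) _ => Ig2 Ig'2.
have qb : 0 < q * b 0 ^+ 2 by rewrite mulr_gt0// exprn_gt0.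
have LE : q * b 0 ^+ 2 * L = q * b 0 ^+ 2 + 2 * s0 * M.
  by rewrite /L mulrDr mulr1 [X in _ + X]mulrC mulfVK// gt_eqF.
have LM : 2 * s0 * M / L < q * b 0 ^+ 2 * L.
  rewrite ltr_pdivrMr// LE; have : 0 <= s0 * M by rewrite mulr_ge0// ltW.
  nra.
rewrite mul0r add0r subr_lt0 /one /= expr1n.
(* The Dirichlet term is at most 4 s0 M / L and the boundary term at least 2 q b(0)^2 L; [LM] is
   half of the inequality between them. *)
apply: (@le_lt_trans _ _ (2 * (2 * s0 * M / L))).
  have -> : 2 * (2 * s0 * M / L) = 2 * s0 * (2 * M / L) by ring.
  by rewrite ler_wpM2l// mulr_ge0// ltW.
apply: (@lt_le_trans _ _ (2 * (q * b 0 ^+ 2 * L))); first by rewrite ltr_pM2l.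
have -> : 2 * (q * b 0 ^+ 2 * L) = q * (1 + 1) * (b 0 ^+ 2 * L) by ring.
by rewrite ler_wpM2l// mulr_ge0// ltW.
Qed.

End Instability.

(** * Sign of integrals, the contact parameter, and the conclusion *)

Lemma Rintegral_le0 (disp : measure_display) (T : measurableType disp)
    (R : realType) (m : {measure set T -> \bar R}) (A : set T) (f : T -> R) :
  (forall t, A t -> f t <= 0) -> \int[m]_(t in A) f t <= 0.
Proof.
(* The positive part integrates to zero, so the extended integral is nonpositive; [fine] preserves
   this sign, an infinite value becoming 0. *)
move=> f0; apply: fine_le0; rewrite integralE integral0_eq.
  by rewrite sub0e oppe_le0; apply: integral_ge0.
by move=> t /f0 ft; rewrite funeposE; apply/max_idPr; rewrite lee_fin.
Qed.

(** The contact parameter may have either sign, and both cases come from the positive one. It is not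
    0, since the symmetry gives x(0) = 0 while x(t0) = s0 > 0. *)
Lemma contact_curvature_reflect (R : realType) (I : set R) (x z : R -> R)
    (D : set 'rV[R]_3) (s0 c t0 gamma : R) (Omega W : set 'rV[R]_3)
    (N : R * R -> 'rV[R]_3) (Nt : 'rV[R]_3 -> 'rV[R]_3) :
  symmetric_curve I x z -> 0 < s0 ->
  capillary_strip I x z s0 c t0 gamma D Omega W N Nt ->
  curvature x z Nt (- t0) = curvature x z Nt t0.
Proof.
move=> sc s0_gt0 [_ [It0 ct0] _ _ _ _ _ _ _ _ uNt _ _].
have xt0 : x t0 = s0.
  by have := congr1 (fun v : 'rV[R]_3 => v 0 0) ct0; rewrite /curve !vec3E.
have [t0_gt0|t0_lt0|t0_0] := ltgtP 0 t0.
- exact: (curvature_reflect sc uNt It0).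
- have IN := curve_dom_sym sc It0.
  have aN : 0 < - t0 by rewrite oppr_gt0.
  by have := curvature_reflect sc uNt IN aN; rewrite opprK => ->.
- have [+ _] := curve_sym sc It0.
  rewrite xt0 -t0_0 oppr0 t0_0 xt0 => /eqP.
  by rewrite -addr_eq0 -mulr2n mulrn_eq0 /= gt_eqF.
Qed.

Theorem theorem3p2 (R : realType) (I : set R) (x z : R -> R)
    (D D' : set 'rV[R]_3) (s0 c t0 gamma : R) (Omega W : set 'rV[R]_3)
    (N : R * R -> 'rV[R]_3) (Nt : 'rV[R]_3 -> 'rV[R]_3) :
  symmetric_curve I x z ->
  separates (cylinder I x z) D D' ->
  0 < s0 ->
  0 < gamma < pi ->
  capillary_strip I x z s0 c t0 gamma D Omega W N Nt ->
  let kappa := curvature x z Nt t0 in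
  let is_beta (beta : R) :=
    kappa / sin gamma < beta /\
    expR (4 * beta * s0) =
      ((beta * sin gamma + kappa) / (beta * sin gamma - kappa)) ^+ 2 in
  (0 < kappa ->
     ~ strip_stable x z s0 c t0 gamma N Nt /\
     (exists! beta : R, is_beta beta) /\
     forall beta : R, is_beta beta ->
       forall h : R, 2 * pi / beta < h ->
         ~ piece_stable x z s0 c t0 gamma N Nt h) /\
  (kappa <= 0 -> strip_strongly_stable x z s0 c t0 gamma N Nt).
Proof.
move=> sc _ s0_gt0 gamma_pi cap kappa is_beta.
have curvN := contact_curvature_reflect sc s0_gt0 cap.
have sin_gt0 : 0 < sin gamma by exact: sin_gt0_pi.
split=> [kappa_gt0|kappa_le0].
- have q_gt0 : 0 < kappa / sin gamma by exact: divr_gt0.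
  have betaP b : is_beta b <-> kappa / sin gamma < b /\
      expR (2 * b * s0) * (b - kappa / sin gamma) = b + kappa / sin gamma.
    by split=> -[qb bE]; split=> //;
      apply/(contact_rate_eq s0 kappa_gt0 sin_gt0 qb).
  split; first exact: strip_unstable.
  split; last first.
    move=> b /betaP[qb bE] h bh.
    exact: (piece_unstable s0_gt0 curvN q_gt0 qb bE bh).
  have [b qb bE] := contact_rate_exists q_gt0 s0_gt0.
  exists b; split; first exact/betaP.
  move=> b' /betaP[qb' bE']; have [bb'|bb'|//] := ltgtP b b'.
    by have := contact_rate_le q_gt0 s0_gt0 qb bb' bE bE'.
  by have := contact_rate_le q_gt0 s0_gt0 qb' bb' bE' bE.
- move=> u _; rewrite (QformE s0 c gamma N _ _ curvN).
  (* As sin gamma > 0, the Robin coefficient has the sign of [kappa], so each boundary integral is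
     nonpositive and its subtraction cannot lower the form. *)
  have q_le0 : kappa / sin gamma <= 0 by rewrite pmulr_lle0 ?invr_gt0.
  have side (a : R) : \int[lebesgue_measure]_(y in setT)
      (kappa / sin gamma * u (a, y) ^+ 2) <= 0.
    by apply: Rintegral_le0 => y _; rewrite mulr_le0_ge0// sqr_ge0.
  rewrite subr_ge0; apply: (@le_trans _ _ 0).
    by rewrite -[leRHS]addr0; apply: lerD; exact: side.
  by apply: Rintegral_ge0 => p _; rewrite addr_ge0 ?sqr_ge0.
Qed.
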